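(* The group $\mathrm{Isom}_e(K_0(\mathbb{P}_6))$ is isomorphic to $\mathbb{Z}^3$ and is generated by the operators \begin{align*} & E\mapsto E\otimes\mathcal{O}(1),\\ & E\mapsto E\otimes(\mathcal{O}+2\mathcal{O}_{\mathbb{P}_3}+3\mathcal{O}_{\mathbb{P}_2}+4\mathcal{O}_{\mathbb{P}_1}+7\mathcal{O}_{\mathbb{P}_0}),\\ & E\mapsto E\otimes(\mathcal{O}+2\mathcal{O}_{\mathbb{P}_1}+5\mathcal{O}_{\mathbb{P}_0}). \end{align*}
   Context: Here $n=6$ in the following. $K_0(\mathbb{P}_n)$ is the Grothendieck group of coherent sheaves on the $n$-dimensional projective space $\mathbb{P}_n$ over a fixed ground field; it is a free $\mathbb{Z}$-module of rank $n+1$ with basis the classes of $\mathcal{O},\mathcal{O}(1),\dots,\mathcal{O}(n)$. A sheaf and its class are denoted by the same letter. The Euler form is the (nonsymmetric) nondegenerate bilinear form $\chi(E,F)=\sum_\nu(-1)^\nu\dim\mathrm{Ext}^\nu(E,F)$; it satisfies $\chi(\mathcal{O}(k),\mathcal{O}(m))=\binom{n+m-k}{n}$ for all $k,m\in\mathbb{Z}$, where $\binom{x}{n}=\frac{x(x-1)\cdots(x-n+1)}{n!}$. It is extended $\mathbb{R}$-bilinearly to $K_0(\mathbb{P}_n)\otimes\mathbb{R}$. $\mathrm{Isom}(K_0(\mathbb{P}_n))$ is the group of $\mathbb{Z}$-linear automorphisms of $K_0(\mathbb{P}_n)$ preserving $\chi$; $\mathrm{Isom}(K_0(\mathbb{P}_n)\otimes\mathbb{R})\subset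 GL(n+1,\mathbb{R})$ is the group of $\mathbb{R}$-linear automorphisms of $K_0(\mathbb{P}_n)\otimes\mathbb{R}$ preserving $\chi$, and $\mathrm{Isom}_e(K_0(\mathbb{P}_n)\otimes\mathbb{R})$ is its connected component of the identity. Regarding $\mathrm{Isom}(K_0(\mathbb{P}_n))$ as a subgroup of $\mathrm{Isom}(K_0(\mathbb{P}_n)\otimes\mathbb{R})$, one sets $\mathrm{Isom}_e(K_0(\mathbb{P}_n))=\mathrm{Isom}(K_0(\mathbb{P}_n))\cap \mathrm{Isom}_e(K_0(\mathbb{P}_n)\otimes\mathbb{R})$. The symbol $\otimes$ between classes denotes the commutative ring structure on $K_0(\mathbb{P}_n)$ induced by tensor product of locally free sheaves; it is the bilinear product with $\mathcal{O}(k)\otimes\mathcal{O}(m)=\mathcal{O}(k+m)$ for all $k,m\in\mathbb{Z}$. For $0\leqslant m\leqslant n$, $\mathcal{O}_{\mathbb{P}_m}$ is the class of the structure sheaf of an $m$-dimensional linear subspace $\mathbb{P}_m\subset\mathbb{P}_n$ (so $\mathcal{O}_{\mathbb{P}_n}=\mathcal{O}$); in the ring $K_0(\mathbb{P}_n)$ one has $\mathcal{O}_{\mathbb{P}_m}=(\mathcal{O}-\mathcal{O}(-1))^{n-m}$. *)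

(* Defs.v *)
From HB Require Import structures.
From mathcomp Require Import all_boot all_order all_algebra.
From mathcomp Require Import all_classical all_reals all_analysis.

Set Implicit Arguments.
Unset Strict Implicit.
Unset Printing Implicit Defensive.

Import Order.TTheory GRing.Theory Num.Theory.
Import numFieldNormedType.Exports.

Local Open Scope classical_set_scope.
Local Open Scope ring_scope.

(* x (x - 1) ... (x - n + 1) / n!, for an arbitrary integer x; the division   *)
(* is exact (binzP).                                                          *)
Definition binz (x : int) (n : nat) : int :=
  ((\prod_(i < n) (x - i%:Z)) %/ n`!%:Z)%Z.

(* K_0(P_n) (x) A is the module of row vectors of coordinates in the basis    *)
(* O, O(1), ..., O(n); K_0(P_n) itself is K0 int n.                           *)
Definition K0 (A : Type) (n : nat) := 'rV[A]_n.+1.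

(* The matrix of E |-> E (x) O(1) acting on row vectors. Its last row is      *)
(* O(n + 1), expressed by the Koszul relation                                 *)
(*   \sum_(j <= n + 1) (-1)^(n + 1 - j) binom(n + 1, j) O(j) = 0.             *)
Definition twist_mx (n : nat) : 'M[int]_n.+1 :=
  \matrix_(i, j) if (i < n)%N then (j == i.+1 :> nat)%:R
                 else (-1) ^+ (n - j) *+ 'C(n.+1, j).

(* The class of the line bundle O(k), for every integer k.                    *)
Definition O_ (n : nat) (k : int) : K0 int n := delta_mx 0 0 *m (twist_mx n ^ k).

Definition tensor (n : nat) (E F : K0 int n) : K0 int n :=
  \sum_(i < n.+1) \sum_(j < n.+1) (E 0 i * F 0 j) *: O_ n (i%:Z + j%:Z).

Definition tensor_mx (n : nat) (F : K0 int n) : 'M[int]_n.+1 :=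
  lin1_mx (fun E => tensor E F).

Definition tensor_exp (n : nat) (E : K0 int n) (m : nat) : K0 int n :=
  iter m (tensor E) (O_ n 0).

(* The class of the structure sheaf of an m-dimensional linear subspace.      *)
Definition O_P (n m : nat) : K0 int n :=
  tensor_exp (O_ n 0 - O_ n (-1)) (n - m).

Definition chi_mx (A : pzRingType) (n : nat) : 'M[A]_n.+1 :=
  \matrix_(i, j) (binz (n%:Z + j%:Z - i%:Z) n)%:~R.

Definition chi (A : pzRingType) (n : nat) (E F : K0 A n) : A :=
  (E *m chi_mx A n *m F^T) 0 0.

(* An automorphism of K0 A n is an invertible matrix acting by E |-> E *m M.  *)
Definition Isom (A : comUnitRingType) (n : nat) : set 'M[A]_n.+1 :=
  [set M | M \in unitmx /\
           forall E F : K0 A n, chi (E *m M) (F *m M) = chi E F].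

Arguments Isom : clear implicits.

Definition Isom_eR (R : realType) (n : nat) : set 'M[R]_n.+1 :=
  connected_component (Isom R n) 1%:M.

Arguments Isom_eR : clear implicits.

Definition Isom_e (R : realType) (n : nat) : set 'M[int]_n.+1 :=
  [set M | Isom int n M /\ Isom_eR R n (map_mx intr M)].

Arguments Isom_e : clear implicits.

Definition unit_subgroup (U : unitRingType) (S : set U) : Prop :=
  [/\ S `<=` [set x | x \is a GRing.unit], S 1,
      forall x y, S x -> S y -> S (x * y) & forall x, S x -> S x^-1].

Definition generated_subgroup (U : unitRingType) (X : set U) : set U :=
  smallest (@unit_subgroup U) X.

(* The rest of the file checks that this model has the properties that        *)
(* characterize K_0(P_n): O, ..., O(n) is the standard basis (O_basis),       *)
(* chi(O(k), O(m)) = binom(n + m - k, n) (chi_O) and O(k) (x) O(m) = O(k + m) *)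
(* (tensor_O) for all integers k and m.                                       *)

Lemma binzP (x : int) n : binz x n * n`!%:Z = \prod_(i < n) (x - i%:Z).
Proof.
suff: (n`!%:Z %| \prod_(i < n) (x - i%:Z))%Z by move/divzK.
case: x => m.
- have [lt_mn|le_nm] := ltnP m n.
    by rewrite (bigD1 (Ordinal lt_mn)) //= subrr mul0r dvdz0.
  suff -> : \prod_(i < n) (m%:Z - i%:Z) = (m ^_ n)%:Z.
    by rewrite -bin_ffact PoszM dvdz_mull.
  rewrite ffact_prod (big_morph Posz PoszM (erefl 1%:Z)).
  by apply: eq_bigr => i _; rewrite subzn // ltnW // (leq_trans _ le_nm).
- suff -> : \prod_(i < n) (Negz m - i%:Z) = (-1) ^+ n * ((m + n) ^_ n)%:Z.
    by rewrite -bin_ffact PoszM mulrA dvdz_mull.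
  rewrite ffact_prod (big_morph Posz PoszM (erefl 1%:Z)).
  rewrite (reindex_inj rev_ord_inj) /= -[X in (-1) ^+ X]card_ord -prodrN.
  apply: eq_bigr => i _; rewrite NegzE -opprD -PoszD; congr (- (Posz _)).
  by rewrite addSn -addnS subnSK // addnBA // ltnW.
Qed.

Lemma binz_nat (m n : nat) : binz m n = 'C(m, n)%:Z.
Proof.
have nz : n`!%:Z != 0 by rewrite eqz_nat -lt0n fact_gt0.
apply: (mulIf nz); rewrite binzP -PoszM bin_ffact.
have [lt_mn|le_nm] := ltnP m n.
  by rewrite (bigD1 (Ordinal lt_mn)) //= subrr mul0r ffact_small.
rewrite ffact_prod (big_morph Posz PoszM (erefl 1%:Z)).
by apply: eq_bigr => i _; rewrite subzn // ltnW // (leq_trans _ le_nm).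
Qed.

Lemma binzS (x : int) n : binz (x + 1) n.+1 - binz x n.+1 = binz x n.
Proof.
have nz : n.+1`!%:Z != 0 by rewrite eqz_nat -lt0n fact_gt0.
apply: (mulIf nz); rewrite mulrBl !binzP factS mulnC PoszM mulrA binzP.
rewrite big_ord_recl big_ord_recr /= subr0.
rewrite (eq_bigr (fun i : 'I_n => x - i%:Z)); last first.
  by move=> i _; rewrite /bump /= add1n -addn1 PoszD opprD addrACA [_ - 1]addrC addrA addrNK.
rewrite mulrC -mulrBr; congr (_ * _).
by rewrite opprB addrC addrA subrK -PoszD addn1.
Qed.

(* Sequences killed by the (n + 1)-st difference are determined by their      *)
(* values at 0, ..., n.                                                       *)
Definition Delta (V : zmodType) (a : int -> V) (s : int) : V := a (s + 1) - a s.

Lemma Delta_eq0 (V : zmodType) n (a : int -> V) :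
  (forall s, iter n (@Delta V) a s = 0) ->
  (forall i, (i < n)%N -> a i%:Z = 0) -> forall s, a s = 0.
Proof.
elim: n a => [|n IHn] a Da a0 s; first exact: Da.
have D0 : forall s, Delta a s = 0.
  apply: IHn => [t|i ltin]; first by rewrite -iterSr Da.
  by rewrite /Delta -PoszD addn1 !a0 ?subr0 // ltnW.
have aS t : a (t + 1) = a t by apply/eqP; rewrite -subr_eq0; apply/eqP/D0.
elim/int_rect: s => [|m IHm|m IHm]; first exact: a0.
  by rewrite -addn1 PoszD aS.
by rewrite -aS -addn1 PoszD opprD subrK.
Qed.

Lemma iter_DeltaB (V : zmodType) m (a b : int -> V) s :
  iter m (@Delta V) (fun t => a t - b t) s =
  iter m (@Delta V) a s - iter m (@Delta V) b s.
Proof.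
elim: m s => // m IHm s.
by rewrite !iterS /Delta !IHm !opprD !opprK addrACA.
Qed.

Lemma iter_Delta_eq (V : zmodType) m (a b : int -> V) :
  a =1 b -> iter m (@Delta V) a =1 iter m (@Delta V) b.
Proof. by move=> ab; elim: m => // m IHm s; rewrite !iterS /Delta !IHm. Qed.

Lemma iter_Delta_shift (V : zmodType) m (a : int -> V) c s :
  iter m (@Delta V) (fun t => a (c + t)) s = iter m (@Delta V) a (c + s).
Proof. by elim: m s => // m IHm s; rewrite !iterS /Delta !IHm addrA. Qed.

Lemma iter_Delta_rev m (a : int -> int) (c s : int) :
  iter m (@Delta int) (fun t => a (c - t)) s =
  (-1) ^+ m * iter m (@Delta int) a (c - s - m%:Z).
Proof.
elim: m s => [|m IHm] s; first by rewrite expr0 mul1r subr0.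
rewrite !iterS [LHS]/Delta !IHm.
have -> : c - (s + 1) - m%:Z = c - s - m.+1%:Z.
  by rewrite -[m.+1]addn1 PoszD !opprD !addrA [RHS]addrAC.
have -> : c - s - m%:Z = c - s - m.+1%:Z + 1.
  by rewrite -[m.+1]addn1 PoszD opprD addrA subrK.
by rewrite -mulrBr exprS mulN1r mulNr -mulrN opprB.
Qed.

Lemma Delta_binz n s : iter n.+1 (@Delta int) (binz^~ n) s = 0.
Proof.
elim: n s => [|n IHn] s.
  by rewrite /= /Delta /binz !big_ord0 subrr.
rewrite iterSr -[RHS](IHn s).
by apply: iter_Delta_eq => t; rewrite /Delta binzS.
Qed.

Lemma delta_twist n (i : 'I_n.+1) :
  delta_mx 0 0 *m (twist_mx n ^+ i) = delta_mx 0 i :> 'rV_n.+1.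
Proof.
case: i => i; elim: i => [|i IHi] lti.
  by rewrite expr0 mulmx1; congr delta_mx; apply: val_inj.
rewrite exprSr mulmxA IHi; first exact: ltnW.
move=> lti'; apply/rowP => j; rewrite -rowE !mxE /=.
by rewrite ifT // -val_eqE /= eq_sym.
Qed.

Lemma row_twist_eq n (M N : 'M[int]_n.+1) :
  (forall i : 'I_n.+1, delta_mx 0 0 *m (twist_mx n ^+ i) *m M
                     = delta_mx 0 0 *m (twist_mx n ^+ i) *m N :> 'rV_n.+1) ->
  M = N.
Proof. by move=> MN; apply/row_matrixP => i; rewrite !rowE -delta_twist MN. Qed.

Lemma twist_nilp n : (twist_mx n - 1) ^+ n.+1 = 0.
Proof.
apply: row_twist_eq => i; rewrite mulmx0 -mulmxA.
have cT : GRing.comm (twist_mx n ^+ i) ((twist_mx n - 1) ^+ n.+1).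
  apply: commrX; apply/commr_sym/commrX/commr_sym.
  by apply: commrB; [exact: commr_refl|exact: commr1].
rewrite [X in _ *m X]cT mulmxA.
suff -> : delta_mx 0 0 *m ((twist_mx n - 1) ^+ n.+1) = 0 :> 'rV_n.+1.
  by rewrite mul0mx.
rewrite addrC exprDn_comm; last exact/commr_sym/commrN1.
rewrite mulmx_sumr big_ord_recr /= subnn expr0 mul1r binn mulr1n.
rewrite exprSr mulmxA (delta_twist ord_max) -rowE.
have scaleE (k : 'I_n.+1) :
    delta_mx 0 0 *m ((-1) ^+ (n.+1 - k) * twist_mx n ^+ k)
    = (-1) ^+ (n.+1 - k) *: delta_mx 0 k :> 'rV_n.+1.
  have -> : (-1) ^+ (n.+1 - k) = ((-1) ^+ (n.+1 - k))%:M :> 'M[int]_n.+1.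
    by rewrite rmorphXn rmorphN1.
  by rewrite -mulmxE mul_scalar_mx -scalemxAr delta_twist.
apply/rowP => j; rewrite !mxE ltnn summxE (bigD1 j) //= big1 => [|k nekj];
  rewrite linearMn /= scaleE mulmxnE !mxE.
  by rewrite !eqxx mulr1 addr0 (subSn (leq_ord j)) exprS mulN1r mulNrn addNr.
by rewrite eqxx /= eq_sym (negPf nekj) mulr0 mul0rn.
Qed.

Lemma twist_unit n : twist_mx n \is a GRing.unit.
Proof.
have := subrX1 (1 - twist_mx n) n.+1.
have -> : (1 - twist_mx n) ^+ n.+1 = 0.
  by rewrite -(opprB (twist_mx n)) exprNn twist_nilp mulr0.
rewrite sub0r [1 - _ - 1]addrAC subrr sub0r mulNr.
set S := \sum_(i < _) _ => /oppr_inj TS.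
exact: (proj1 (mulmx1_unit (esym TS))).
Qed.

Lemma O_basis n (i : 'I_n.+1) : O_ n i%:Z = delta_mx 0 i.
Proof. exact: delta_twist. Qed.

Lemma O_D n (s t : int) : O_ n (s + t) = O_ n s *m twist_mx n ^ t.
Proof. by rewrite /O_ -mulmxA mulmxE -exprzDr // twist_unit. Qed.

Lemma Delta_O n s : iter n.+1 (@Delta _) (O_ n) s = 0.
Proof.
suff -> m : iter m (@Delta _) (O_ n) s = O_ n s *m (twist_mx n - 1) ^+ m.
  by rewrite twist_nilp mulmx0.
elim: m s => [|m IHm] s; first by rewrite mulmx1.
rewrite iterS /Delta !IHm O_D expr1z exprS -mulmxE mulmxA mulmxBr mulmx1.
by rewrite -mulmxBl.
Qed.

Lemma chiBl (A : pzRingType) n (F E1 E2 : K0 A n) : chi (E1 - E2) F = chi E1 F - chi E2 F.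
Proof. by rewrite /chi !mulmxBl !mxE. Qed.

Lemma chiBr (A : pzRingType) n (E F1 F2 : K0 A n) : chi E (F1 - F2) = chi E F1 - chi E F2.
Proof. by rewrite /chi linearB mulmxBr !mxE. Qed.

Lemma chi_O n (k m : int) : chi (O_ n k) (O_ n m) = binz (n%:Z + m - k) n.
Proof.
have iterf (f : K0 int n -> int) : (forall x y, f (x - y) = f x - f y) ->
    forall s, iter n.+1 (@Delta _) (fun t => f (O_ n t)) s = 0.
  move=> fB s; suff -> p : iter p (@Delta _) (fun t => f (O_ n t)) s
                         = f (iter p (@Delta _) (O_ n) s).
    by rewrite Delta_O -(subrr 0) fB subrr.
  by elim: p s => // p IHp s; rewrite !iterS /Delta !IHp fB.
have chiE (i : 'I_n.+1) t : chi (O_ n i%:Z) (O_ n t) = binz (n%:Z + t - i%:Z) n.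
  apply/eqP; rewrite -subr_eq0; apply/eqP.
  apply: (@Delta_eq0 _ n.+1
    (fun t => chi (O_ n i%:Z) (O_ n t) - binz (n%:Z + t - i%:Z) n)) => [s|j ltj].
    rewrite iter_DeltaB iterf ?sub0r; last exact: chiBr.
    rewrite (@iter_Delta_eq _ _ _ (fun t => binz ((n%:Z - i%:Z) + t) n)).
      by rewrite (@iter_Delta_shift _ _ (binz^~ n)) Delta_binz oppr0.
    by move=> u; rewrite addrAC.
  rewrite (O_basis (Ordinal ltj)) O_basis /chi -rowE trmx_delta -colE !mxE /=.
  by rewrite intz subrr.
apply/eqP; rewrite -subr_eq0; apply/eqP.
apply: (@Delta_eq0 _ n.+1
  (fun k => chi (O_ n k) (O_ n m) - binz (n%:Z + m - k) n)) => [s|j ltj].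
  rewrite iter_DeltaB (@iterf (fun E => chi E _)) ?sub0r; last exact: chiBl.
  by rewrite (@iter_Delta_rev _ (binz^~ n)) Delta_binz mulr0 oppr0.
by rewrite (chiE (Ordinal ltj)) subrr.
Qed.

Lemma tensorE n (E F : K0 int n) :
  tensor E F = E *m \sum_(j < n.+1) F 0 j *: twist_mx n ^+ j.
Proof.
rewrite [in RHS](row_sum_delta E) mulmx_suml; apply: eq_bigr => i _.
rewrite mulmx_sumr; apply: eq_bigr => j _.
by rewrite O_D O_basis -!scalemxAr -scalemxAl scalerA mulrC.
Qed.

Lemma mul_tensor_mx n (E F : K0 int n) : E *m tensor_mx F = tensor E F.
Proof.
rewrite tensorE; set M := \sum_(j < _) _; congr (_ *m _).
by apply/matrixP => i j; rewrite mxE tensorE -rowE mxE.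
Qed.

Lemma tensor_O n (k m : int) : tensor (O_ n k) (O_ n m) = O_ n (k + m).
Proof.
rewrite tensorE O_D; congr (_ *m _); apply: row_twist_eq => i.
rewrite mulmx_sumr.
transitivity (O_ n m *m twist_mx n ^+ i); last first.
  by rewrite -[RHS]/(O_ n i%:Z *m _) -O_D addrC O_D.
rewrite [in RHS](row_sum_delta (O_ n m)) mulmx_suml; apply: eq_bigr => j _.
rewrite -scalemxAr -scalemxAl; congr (_ *: _).
by rewrite delta_twist -!O_basis -(O_D _ _ j%:Z) -(O_D _ _ i%:Z) addrC.
Qed.

(* Main.v *)
Require Import Defs.
From HB Require Import structures.
From mathcomp Require Import all_boot all_order all_algebra.
From mathcomp Require Import all_classical all_reals all_analysis.
From mathcomp Require Import perm ring zify.

Import Order.TTheory GRing.Theory Num.Theory.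
Import numFieldNormedType.Exports.

Local Open Scope classical_set_scope.
Local Open Scope ring_scope.

(* Write T for E |-> E (x) O(1) and h = 1 - T^-1, so that h^7 = 0. By Serre   *)
(* duality every isometry commutes with T^7, hence with the unipotent T, so   *)
(* it is a polynomial p(h) with integral coefficients; as T is adjoint to     *)
(* T^-1, the isometries are the solutions of p(h) p(1 - T) = 1. The determinant *)
(* and the polynomial one-parameter group t |-> M^t of a unipotent isometry M *)
(* show that the identity component is cut out by p(0) = 1. Comparing leading *)
(* terms, an isometry 1 + m h^k + ... has m = 0 for k even, and m even for    *)
(* k = 3, 5. The three generators have leading terms h, 2 h^3 and 2 h^5, so   *)
(* an isometry is reduced to 1 by dividing out their powers one at a time.    *)

(** The isometries are filtered by powers of h, and the graded pieces can be computed. By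
    [Isom_hyp_poly] every integral isometry lies in the commutative ring Z[h]/(h^7), and
    [Isom_hyp_polyP] says that p(h) is an isometry when its product with its dual is 1, the dual
    replacing h by 1 - T = - h / (1 - h). To first order this substitution acts on h^k by (-1)^k,
    which kills leading coefficients of even degree ([Isom_lead_even]); its second-order term makes
    those of degrees 3 and 5 even ([Isom_lead_odd]). What remains is at most Z, 2Z, 2Z in degrees 1,
    3, 5, and the three operators attain generators of these groups, whence existence and uniqueness
    of the exponents ([Isom_e_decomposition], [decomposition_inj]). Topology enters only through
    [Isom_eP]. *)

Lemma chi_mx_map (A : pzRingType) n : chi_mx A n = map_mx intr (chi_mx int n).
Proof. by apply/matrixP => i j; rewrite !mxE intz. Qed.

(** The line bundles form an exceptional collection: their Gram matrix is triangular with unit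
    diagonal. *)
Lemma det_chi_mx (A : comPzRingType) n : \det (chi_mx A n) = 1.
Proof.
rewrite -det_tr det_trig => [|]; last first.
  apply/is_trig_mxP => i j lt_ij; rewrite !mxE.
  have := leq_ord j; have := leq_ord i => le_in le_jn.
  by rewrite -PoszD subzn ?binz_nat ?bin_small //; lia.
by rewrite big1 // => i _; rewrite !mxE addrK binz_nat binn.
Qed.

Lemma chi_mx_unit (A : comUnitRingType) n : chi_mx A n \in unitmx.
Proof. by rewrite unitmxE det_chi_mx unitr1. Qed.

Lemma chi_rows (A : pzRingType) n (M N : 'M[A]_n.+1) i j :
  (M *m chi_mx A n *m N^T) i j = chi (row i M) (row j N).
Proof. by rewrite /chi tr_row -row_mul !mxE; apply: eq_bigr => k _; rewrite !mxE. Qed.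

Lemma Isom_det (A : comUnitRingType) n (M : 'M[A]_n.+1) :
  M *m chi_mx A n *m M^T = chi_mx A n -> \det M * \det M = 1.
Proof. by move/(congr1 determinant); rewrite !det_mulmx det_tr det_chi_mx mulr1. Qed.

(** Invertibility follows from the equation, since [\det M] is then its own inverse. *)
Lemma IsomP (A : comUnitRingType) n (M : 'M[A]_n.+1) :
  Isom A n M <-> M *m chi_mx A n *m M^T = chi_mx A n.
Proof.
split=> [[_ chiM]|MX].
  apply/matrixP => i j; rewrite chi_rows !rowE chiM -!row1 -chi_rows.
  by rewrite trmx1 mulmx1 mul1mx.
split; first by rewrite unitmxE; apply/unitrPr; exists (\det M); exact: Isom_det.
by move=> E F; rewrite /chi trmx_mul !mulmxA -(mulmxA E) -(mulmxA E) MX.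
Qed.

Lemma Isom_map (R : numFieldType) n (M : 'M[int]_n.+1) :
  Isom R n (map_mx intr M) <-> Isom int n M.
Proof.
rewrite !IsomP chi_mx_map map_trmx -!map_mxM; split=> [|->//].
move/matrixP => MX; apply/matrixP => i j.
by have := MX i j; rewrite [LHS]mxE [RHS]mxE => /intr_inj.
Qed.

Lemma Isom1 (A : comUnitRingType) n : Isom A n 1.
Proof. by apply/IsomP; rewrite trmx1 mul1mx mulmx1. Qed.

Lemma IsomM (A : comUnitRingType) n (M N : 'M[A]_n.+1) :
  Isom A n M -> Isom A n N -> Isom A n (M * N).
Proof.
rewrite !IsomP -!mulmxE trmx_mul !mulmxA => MX NX.
by rewrite -(mulmxA M) -(mulmxA M) NX.
Qed.

Lemma IsomV (A : comUnitRingType) n (M : 'M[A]_n.+1) :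
  Isom A n M -> Isom A n M^-1.
Proof.
move=> iM; have uM : M \in unitmx by case: iM.
move/IsomP: iM => MX; apply/IsomP; rewrite -{1}MX -[M^-1]/(invmx M).
by rewrite !mulmxA mulVmx // mul1mx -mulmxA -trmx_mul mulVmx // trmx1 mulmx1.
Qed.

Lemma IsomX (A : comUnitRingType) n (M : 'M[A]_n.+1) k :
  Isom A n M -> Isom A n (M ^+ k).
Proof.
by move=> iM; elim: k => [|k IHk]; rewrite ?exprS; [exact: Isom1|exact: IsomM].
Qed.

(** * Serre duality *)

Lemma row_twistX n k (i : 'I_n.+1) : row i (twist_mx n ^+ k) = O_ n (i%:Z + k%:Z).
Proof. by rewrite O_D O_basis rowE. Qed.

Lemma twist_chi n : twist_mx n *m chi_mx int n *m (twist_mx n)^T = chi_mx int n.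
Proof.
apply/matrixP => i j; rewrite chi_rows -[twist_mx n]expr1 !row_twistX chi_O mxE intz.
by congr binz; lia.
Qed.

Lemma binz_reflect n (x : int) : binz (n%:Z - 1 - x) n = (-1) ^+ n * binz x n.
Proof.
have nz : n`!%:Z != 0 by rewrite eqz_nat -lt0n fact_gt0.
apply: (mulIf nz); rewrite -mulrA !binzP (reindex_inj rev_ord_inj) /=.
rewrite -[X in (-1) ^+ X]card_ord -prodrN; apply: eq_bigr => i _.
by have := ltn_ord i; lia.
Qed.

(* Serre duality: chi(F, E) = (-1)^n chi(E (x) O(n + 1), F). *)
Lemma trmx_chi n : (chi_mx int n)^T = (-1) ^+ n *: (twist_mx n ^+ n.+1 *m chi_mx int n).
Proof.
apply/matrixP => i j; rewrite mxE [RHS]mxE mxE intz.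
rewrite -(mulmx1 (_ *m _)) -trmx1 chi_rows row_twistX.
by rewrite rowE mulmx1 -O_basis chi_O -binz_reflect; congr binz; lia.
Qed.

(** An isometry preserves the form and its transpose alike, so it commutes with the operator that
    relates them, which is T^(n+1) up to sign. *)
Lemma Isom_comm_twistX n (M : 'M[int]_n.+1) :
  Isom int n M -> GRing.comm M (twist_mx n ^+ n.+1).
Proof.
move=> iM; have uM : M \in unitmx by case: iM.
move/IsomP: iM => MX.
have: M *m (chi_mx int n)^T *m M^T = (chi_mx int n)^T.
  by rewrite -[X in X *m _ *m _]trmxK -!trmx_mul mulmxA MX.
rewrite trmx_chi -scalemxAr -scalemxAl => /(can_inj (signrZK n)); rewrite -{2}MX !mulmxA.
have uMt : M^T \in unitmx by rewrite unitmx_tr.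
by move/(can_inj (mulmxK uMt))/(can_inj (mulmxK (chi_mx_unit _ _))).
Qed.

(** * Commuting with a power of a unipotent matrix *)

Lemma expr1X_sub1 k : exists w : {poly int},
  (1 + 'X) ^+ k - 1 = 'X * (k%:R + 'X * w).
Proof.
elim: k => [|k [w IHk]]; first by exists 0; ring.
exists (w + k%:R + 'X * w).
by rewrite exprSr -[_ ^+ k](subrK 1) IHk -natr1; ring.
Qed.

Lemma exprCX (c : {poly int}) (w : {poly int}) k : exists w',
  (c + 'X * w) ^+ k = c ^+ k + 'X * w'.
Proof.
elim: k => [|k [w' IHk]]; first by exists 0; ring.
by exists (w * c ^+ k + c * w' + 'X * w * w'); rewrite !exprS IHk; ring.
Qed.

(* Descending induction on i: ((1 + N)^k.+1 - 1)^i is k.+1^i N^i plus higher  *)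
(* powers of N, and integral matrices have no torsion.                        *)
Lemma unipotent_root_comm n m k (M N : 'M[int]_n.+1) :
  N ^+ m = 0 -> GRing.comm M ((1 + N) ^+ k.+1) -> GRing.comm M N.
Proof.
move=> Nm cMN.
suff comm_pow j i : (m <= i + j)%N -> GRing.comm M (N ^+ i).
  by apply: (comm_pow m 1%N); rewrite leq_addl.
elim: j i => [|j IHj] i le_m.
  rewrite addn0 in le_m.
  by rewrite -(subnK le_m) exprD Nm mulr0; exact: commr0.
have [w ew] := expr1X_sub1 k.+1; have [w' ew'] := exprCX k.+1%:R w i.
have hN : horner_mx N 'X = N by exact: horner_mx_X.
have: GRing.comm M (((1 + N) ^+ k.+1 - 1) ^+ i).
  by apply: commrX; apply: commrB; [exact: cMN|exact: commr1].
have -> : ((1 + N) ^+ k.+1 - 1) ^+ i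
    = N ^+ i *+ (k.+1 ^ i) + horner_mx N ('X^(i.+1) * w').
  have -> : (1 + N) ^+ k.+1 - 1 = horner_mx N ((1 + 'X) ^+ k.+1 - 1).
    by rewrite rmorphB rmorphXn rmorphD rmorph1 /= hN.
  rewrite -rmorphXn ew exprMn ew' mulrDr rmorphD -natrX; congr (_ + _).
    by rewrite mulr_natr rmorphMn rmorphXn /= hN.
  by rewrite exprSr mulrA.
have cw : GRing.comm M (horner_mx N ('X^(i.+1) * w')).
  rewrite -[w']coefK poly_def mulr_sumr rmorph_sum /=; apply: commr_sum => l _.
  rewrite -scalerAr -exprD linearZ rmorphXn /= hN.
  rewrite /GRing.comm -mulmxE -scalemxAr -scalemxAl; congr (_ *: _).
  by apply: IHj; lia.
move=> cD; have: GRing.comm M (N ^+ i *+ (k.+1 ^ i)).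
  by have := commrB cD cw; rewrite addrK.
rewrite /GRing.comm mulrnAr mulrnAl => /matrixP e; apply/matrixP => a b.
by have /eqP := e a b; rewrite !mulmxnE eqr_pMn2r ?expn_gt0 // => /eqP.
Qed.

(** * Polynomials in the hyperplane class *)

(* The operator of multiplication by the class O - O(-1) of a hyperplane. *)
Definition hyp_mx n : 'M[int]_n.+1 := 1 - (twist_mx n)^-1.

Lemma hyp_mxE n : hyp_mx n = (twist_mx n)^-1 * (twist_mx n - 1).
Proof. by rewrite mulrBr mulVr ?twist_unit // mulr1. Qed.

Lemma hyp_mxX n k : hyp_mx n ^+ k = (twist_mx n)^-1 ^+ k * (twist_mx n - 1) ^+ k.
Proof.
rewrite hyp_mxE exprMn_comm //; apply: commrB; last exact: commr1.
by rewrite /GRing.comm mulVr ?mulrV ?twist_unit.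
Qed.

Lemma hyp_mx_nilp n : hyp_mx n ^+ n.+1 = 0.
Proof. by rewrite hyp_mxX twist_nilp mulr0. Qed.

(** Up to a unit h^n is (T - 1)^n, which sends O to a class with coefficient 1 on O(n). *)
Lemma hyp_mx_neq0 n : hyp_mx n ^+ n != 0.
Proof.
rewrite hyp_mxX; apply/eqP => h0.
have uT : (twist_mx n)^-1 ^+ n \is a GRing.unit by rewrite unitrX // unitrV twist_unit.
have {h0} N0 : (twist_mx n - 1) ^+ n = 0 by apply: (mulrI uT); rewrite h0 mulr0.
have := congr1 (fun M : 'M[int]_n.+1 => (delta_mx 0 0 *m M : 'rV[int]_n.+1) 0 ord_max) N0.
rewrite mulmx0 [in RHS]mxE addrC exprDn_comm; last exact/commr_sym/commrN1.
rewrite mulmx_sumr summxE big_ord_recr /= subnn expr0 mul1r binn mulr1n.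
rewrite (delta_twist ord_max) mxE !eqxx /= big1 ?add0r // => i _.
rewrite linearMn /= -[(-1) ^+ _](@rmorph_sign _ _ (@scalar_mx int n.+1)).
rewrite -mulmxE mul_scalar_mx -scalemxAr.
rewrite (delta_twist (widen_ord (leqnSn n) i)) mulmxnE !mxE.
by rewrite -(val_eqE ord_max) /= gtn_eqF ?andbF ?mulr0 ?mul0rn.
Qed.

Local Notation hyp_poly n := (horner_mx (hyp_mx n)).

Lemma hyp_polyX n : hyp_poly n 'X = hyp_mx n.
Proof. exact: horner_mx_X. Qed.

Lemma hyp_poly_Xmul0 n k p : (n < k)%N -> hyp_poly n ('X^k * p) = 0.
Proof.
move=> /subnK <-; rewrite exprD !rmorphM !rmorphXn /= hyp_polyX.
by rewrite hyp_mx_nilp mulr0 mul0r.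
Qed.

Lemma hyp_poly_comm n p q : hyp_poly n p * hyp_poly n q = hyp_poly n q * hyp_poly n p.
Proof. by rewrite -!rmorphM mulrC. Qed.

(** Multiplying by h^(n-k) leaves only m h^n, and h^n is a nonzero integral matrix. *)
Lemma hyp_poly_lead n k (m : int) p :
  (k <= n)%N -> hyp_poly n (m%:P * 'X^k + 'X^(k.+1) * p) = 0 -> m = 0.
Proof.
move=> le_kn p0; have := hyp_mx_neq0 n.
have : hyp_poly n (m%:P * 'X^n + 'X^(n.+1) * p) = 0.
  have -> : m%:P * 'X^n + 'X^(n.+1) * p = 'X^(n - k) * (m%:P * 'X^k + 'X^(k.+1) * p).
    by rewrite mulrDr mulrCA -exprD mulrA -exprD addnS subnK.
  by rewrite rmorphM /= p0 mulr0.
rewrite rmorphD /= hyp_poly_Xmul0 // addr0 rmorphM rmorphXn /= horner_mx_C hyp_polyX.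
by rewrite -mulmxE mul_scalar_mx => /eqP; rewrite scalemx_eq0 => /orP[/eqP|->].
Qed.

Lemma twistV_hyp_poly n : (twist_mx n)^-1 = hyp_poly n (1 - 'X).
Proof.
by rewrite rmorphB rmorph1 /= hyp_polyX /hyp_mx opprB addrCA subrr addr0.
Qed.

(** The geometric series for T = 1 / (1 - h), finite because h is nilpotent. *)
Lemma twist_hyp_poly n : twist_mx n = hyp_poly n (\sum_(i < n.+1) 'X^i).
Proof.
apply: (@mulIr _ (twist_mx n)^-1); first by rewrite unitrV twist_unit.
rewrite mulrV ?twist_unit // twistV_hyp_poly -rmorphM mulrC.
rewrite -opprB mulNr -subrX1 opprB rmorphB rmorph1 /=.
by rewrite -['X^_]mulr1 hyp_poly_Xmul0 // subr0.
Qed.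

(** O is a cyclic vector for T: an operator commuting with T is determined by the image of O, and
    the coordinates of that image give a polynomial in T, hence in h. *)
Lemma Isom_hyp_poly n (M : 'M[int]_n.+1) :
  Isom int n M -> exists p, M = hyp_poly n p.
Proof.
move=> iM; have cT : GRing.comm M (twist_mx n).
  have cN : GRing.comm M (twist_mx n - 1).
    apply: (@unipotent_root_comm n n.+1 n); first exact: twist_nilp.
    by rewrite addrCA subrr addr0; exact: Isom_comm_twistX.
  by have := commrD cN (commr1 M); rewrite subrK.
pose T := \sum_(i < n.+1) ('X^i : {poly int}).
exists (\sum_(j < n.+1) (M 0 j)%:P * T ^+ j); rewrite rmorph_sum /=.
apply: row_twist_eq => i; rewrite -!mulmxA.
have cTi (N : 'M[int]_n.+1) : GRing.comm N (twist_mx n) ->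
    twist_mx n ^+ i *m N = N *m twist_mx n ^+ i.
  by move=> cN; exact/esym/(commrX i cN).
rewrite !cTi //; last first.
  apply/commr_sym/commr_sum => j _; rewrite twist_hyp_poly; exact: hyp_poly_comm.
rewrite !mulmxA; congr (_ *m _).
rewrite -rowE [LHS]row_sum_delta mulmx_sumr; apply: eq_bigr => j _.
rewrite rmorphM rmorphXn /= -twist_hyp_poly horner_mx_C.
by rewrite -mulmxE mul_scalar_mx -scalemxAr delta_twist mxE.
Qed.

(* Its value at h = 1 - T^-1 is 1 - T, the adjoint of h for chi. *)
Definition hyp_dual n : {poly int} := 1 - \sum_(i < n.+1) 'X^i.

Lemma hyp_poly_dual n : hyp_poly n (hyp_dual n) = 1 - twist_mx n.
Proof. by rewrite rmorphB rmorph1 /= -twist_hyp_poly. Qed.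

Lemma hyp_poly_adjoint n p :
  hyp_poly n p *m chi_mx int n = chi_mx int n *m (hyp_poly n (p \Po hyp_dual n))^T.
Proof.
elim/poly_ind: p => [|p c IHp]; first by rewrite comp_poly0 !rmorph0 trmx0 mulmx0 mul0mx.
rewrite comp_polyD comp_polyM comp_polyX comp_polyC !rmorphD !rmorphM /=.
rewrite hyp_polyX !horner_mx_C.
rewrite hyp_poly_dual linearD /= mulmxDl mulmxDr tr_scalar_mx -scalar_mxC; congr (_ + _).
(* Invariance of the form under T makes T adjoint to its inverse. *)
have hX : hyp_mx n *m chi_mx int n = chi_mx int n *m (1 - twist_mx n)^T.
  rewrite /hyp_mx linearB /= trmx1 mulmxBl mulmxBr mul1mx mulmx1; congr (_ - _).
  by rewrite -{1}(twist_chi n) !mulmxA [_ *m twist_mx n]mulVr ?twist_unit // mul1mx.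
rewrite -!mulmxE -mulmxA hX mulmxA IHp -mulmxA -trmx_mul; congr (_ *m _^T).
by rewrite -hyp_poly_dual; exact: hyp_poly_comm.
Qed.

Lemma Isom_hyp_polyP n p :
  Isom int n (hyp_poly n p) <-> hyp_poly n (p * (p \Po hyp_dual n)) = 1.
Proof.
rewrite IsomP hyp_poly_adjoint -mulmxA -trmx_mul rmorphM /=; split=> [|e].
  rewrite -[X in _ = X]mulmx1 -trmx1 => /(can_inj (mulKmx (chi_mx_unit _ _))).
  exact: trmx_inj.
by rewrite mulmxE e trmx1; exact: mulmx1.
Qed.

(** * Unipotent one-parameter groups and the real identity component *)

Definition binom_poly (R : realType) (k : nat) : {poly R} :=
  (k`!%:R)^-1 *: \prod_(i < k) ('X - i%:R%:P).

Lemma binom_polyE (R : realType) k m : (binom_poly R k).[m%:R] = 'C(m, k)%:R.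
Proof.
rewrite hornerZ horner_prod; apply: (canLR (mulKf _)).
  by rewrite pnatr_eq0 -lt0n fact_gt0.
rewrite -natrM mulnC bin_ffact (eq_bigr (fun i : 'I_k => m%:R - i%:R)); last first.
  by move=> i _; rewrite hornerXsubC.
have [lt_mk|le_km] := ltnP m k.
  by rewrite (bigD1 (Ordinal lt_mk)) //= subrr mul0r ffact_small.
rewrite ffact_prod natr_prod; apply: eq_bigr => i _.
by rewrite natrB // ltnW // (leq_trans _ le_km).
Qed.

(* The one-parameter group t |-> M ^ t of a unipotent matrix M, with entries  *)
(* polynomial in t.                                                           *)
Definition unip_path {R : realType} {n : nat} (M : 'M[R]_n.+1) : 'M[{poly R}]_n.+1 :=
  \sum_(k < n.+1) binom_poly R k *: map_mx polyC ((M - 1) ^+ k).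

Definition unip_pow {R : realType} {n : nat} (M : 'M[R]_n.+1) (t : R) :
    'M[R]_n.+1 :=
  map_mx (horner^~ t) (unip_path M).

Lemma unip_powE {R : realType} {n : nat} (M : 'M[R]_n.+1) (t : R) :
  unip_pow M t = \sum_(k < n.+1) (binom_poly R k).[t] *: (M - 1) ^+ k.
Proof.
apply/matrixP => i j; rewrite mxE /unip_path [in LHS]summxE [RHS]summxE horner_sum.
by apply: eq_bigr => k _; rewrite !mxE hornerM hornerC.
Qed.

Lemma sum_ord_vanish (V : nmodType) (F : nat -> V) a b :
  (forall i, (a <= i)%N -> F i = 0) -> \sum_(i < a + b) F i = \sum_(i < a) F i.
Proof.
move=> F0; rewrite big_split_ord /= [X in _ + X]big1 ?addr0 // => i _.
by rewrite F0 ?leq_addr.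
Qed.

Lemma unip_pow_nat {R : realType} {n : nat} (M : 'M[R]_n.+1) (m : nat) :
  (M - 1) ^+ n.+1 = 0 -> unip_pow M m%:R = M ^+ m.
Proof.
move=> nil; rewrite unip_powE -{2}[M](subrK 1) [X in X ^+ m]addrC exprDn_comm;
  last exact/commr_sym/commr1.
pose F i := (M - 1) ^+ i *+ 'C(m, i).
rewrite (eq_bigr (fun i : 'I_n.+1 => F i)); last first.
  by move=> k _; rewrite binom_polyE scaler_nat.
rewrite [RHS](eq_bigr (fun i : 'I_m.+1 => F i)); last first.
  by move=> k _; rewrite expr1n mul1r.
(* Both sums are extended to [n.+1 + m.+1] terms: nilpotency kills those beyond n, the binomial
   coefficients those beyond m. *)
rewrite -(@sum_ord_vanish _ F n.+1 m.+1) => [|i lt_i]; last first.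
  by rewrite /F -(subnK lt_i) exprD nil mulr0 mul0rn.
by rewrite addnC sum_ord_vanish // => i lt_i; rewrite /F bin_small.
Qed.

Lemma poly_nat_eq0 {R : realType} (p : {poly R}) :
  (forall m : nat, p.[m%:R] = 0) -> p = 0.
Proof.
move=> p0; apply: (@roots_geq_poly_eq0 _ p [seq i%:R | i <- iota 0 (size p)]).
- by apply/allP => _ /mapP[i _ ->]; apply/rootP.
- by rewrite map_inj_uniq ?iota_uniq // => i j /eqP; rewrite eqr_nat => /eqP.
- by rewrite size_map size_iota.
Qed.

Lemma unip_pow_Isom {R : realType} {n : nat} (M : 'M[R]_n.+1) (t : R) :
  (M - 1) ^+ n.+1 = 0 -> Isom R n M -> Isom R n (unip_pow M t).
Proof.
move=> nil iM.
pose X := map_mx polyC (chi_mx R n).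
pose F := unip_path M *m X *m (unip_path M)^T - X.
have FE s : map_mx (horner^~ s) F
    = unip_pow M s *m chi_mx R n *m (unip_pow M s)^T - chi_mx R n.
  have XE : map_mx (horner_eval s) X = chi_mx R n.
    by apply/matrixP => i j; rewrite !mxE /horner_eval hornerC.
  by rewrite -[LHS]/(map_mx (horner_eval s) F) map_mxB !map_mxM map_trmx XE.
(* For t a natural number, unip_pow M t is the isometry M ^+ t. *)
have F0 : F = 0.
  apply/matrixP => i j; rewrite [RHS]mxE; apply: poly_nat_eq0 => m.
  have := congr1 (fun N : 'M[R]_n.+1 => N i j) (FE m%:R); rewrite mxE => ->.
  rewrite unip_pow_nat //; have /IsomP -> := IsomX _ _ _ m iM.
  by rewrite subrr mxE.
apply/IsomP/eqP; rewrite -subr_eq0 -FE F0; apply/eqP/matrixP => i j.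
by rewrite !mxE horner0.
Qed.

Lemma mx_continuous {R : realType} {n : nat} (T : topologicalType) (f : T -> 'M[R]_n.+1) :
  (forall i j, continuous (fun x => f x i j)) -> continuous f.
Proof.
move=> cf x A [P nP sPA]; apply: (@filterS _ (nbhs x) _ _ _ (fun y => sPA (f y))).
by apply: filter_forall => i; apply: filter_forall => j; exact/cf/nP.
Qed.

Lemma unip_pow_continuous {R : realType} {n : nat} (M : 'M[R]_n.+1) :
  continuous (unip_pow M).
Proof.
apply: mx_continuous => i j.
rewrite (_ : (fun t => unip_pow M t i j) = horner (unip_path M i j)).
  exact: continuous_horner.
by apply/funext => t; rewrite mxE.
Qed.

(** The path t |-> M^t, for t in [0, 1], joins 1 to M inside the isometry group. *)
Lemma unipotent_Isom_eR {R : realType} {n : nat} (M : 'M[R]_n.+1) :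
  (M - 1) ^+ n.+1 = 0 -> Isom R n M -> Isom_eR R n M.
Proof.
move=> nil iM.
have E0 : unip_pow M 0 = 1%:M by have := unip_pow_nat M 0 nil.
have E1 : unip_pow M 1 = M by have := unip_pow_nat M 1 nil.
have : (unip_pow M @` `[0, 1]) M by exists 1; rewrite //= in_itv /= ler01 lexx.
apply: connected_component_max.
- by exists 0; rewrite //= in_itv /= ler01 lexx.
- by move=> _ [t _ <-]; exact: unip_pow_Isom.
- apply: connected_continuous_connected; first exact: segment_connected.
  by apply: continuous_subspaceT; exact: unip_pow_continuous.
Qed.

Lemma det_continuous (R : realType) n : continuous (fun M : 'M[R]_n.+1 => \det M).
Proof.
apply: (@continuous_big _ _ +%R 0 predT (@add_continuous R)) => s _.
have cprod : continuous (fun M : 'M[R]_n.+1 => \prod_i M i (s i)).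
  apply: (@continuous_big R _ *%R 1 predT (@mul_continuous R)) => i _.
  exact: coord_continuous.
move=> M; exact: (@continuousM R _ (fun=> (-1) ^+ s) _ M
  (@cst_continuous _ _ _ _) (cprod M)).
Qed.

(** The determinant is continuous with values 1 and -1 on isometries; a connected image containing
    both would contain 0. *)
Lemma Isom_eR_det {R : realType} {n : nat} (M : 'M[R]_n.+1) : Isom_eR R n M -> \det M = 1.
Proof.
move=> cM.
have sq N : Isom_eR R n N -> \det N = 1 \/ \det N = -1.
  move=> /connected_component_sub/IsomP/Isom_det; rewrite -expr2.
  by move/eqP; rewrite sqrf_eq1 => /orP[]/eqP; [left|right].
case: (sq M cM) => // dM.
have : connected ((fun M : 'M[R]_n.+1 => \det M) @` Isom_eR R n).
  apply: connected_continuous_connected; first exact: component_connected.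
  by apply: continuous_subspaceT; exact: det_continuous.
move/connected_intervalP => itv.
have [|||N cN dN] := itv (-1) 1 _ _ 0.
- by exists M.
- exists 1%:M; last exact: det1.
  exact/connected_component_refl/Isom1.
- by rewrite lerN10 ler01.
by case: (sq N cN); rewrite dN => /eqP; rewrite eq_sym ?oppr_eq0 oner_eq0.
Qed.

(** * Leading terms in the h-adic filtration *)

(** Here m is the symbol of u in degree k. It may be zero, in which case u lies one step deeper in
    the filtration ([lead_next]). *)
Definition lead n k (m : int) (u : 'M[int]_n.+1) :=
  exists r, u = hyp_poly n (1 + m%:P * 'X^k + 'X^(k.+1) * r).

Lemma poly_cons0 (r : {poly int}) : exists c s, r = c%:P + 'X * s.
Proof.
exists (r`_0), (drop_poly 1 r); rewrite -{1}(poly_take_drop 1 r) expr1 mulrC.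
by congr (_ + _); apply/polyP => i; rewrite coef_take_poly coefC; case: i.
Qed.

(** For k > 0 the product of the two leading terms has degree 2k > k, so symbols add. *)
Lemma leadM n k m m' u u' : (0 < k)%N ->
  lead n k m u -> lead n k m' u' -> lead n k (m + m') (u * u').
Proof.
case: k => // k _ [r ->] [r' ->]; rewrite -rmorphM /lead !exprS.
exists (r + r' + 'X^k * (m%:P + 'X * r) * (m'%:P + 'X * r')).
by congr horner_mx; ring.
Qed.

Lemma lead1 n k : lead n k 0 1.
Proof. by exists 0; rewrite mul0r mulr0 !addr0 rmorph1. Qed.

Lemma leadV n k m u : (0 < k)%N -> lead n k m u -> lead n k (- m) u^-1.
Proof.
case: k => // k _ [r ->].
(* With this x the given polynomial is 1 - X x, inverted by a truncated geometric series v. Its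
   first two terms are split off to show the symbol - m. *)
pose x := - (m%:P + 'X * r) * 'X^k : {poly int}.
pose v := 1 + 'X * x + ('X * x) ^+ 2 * \sum_(i < n) ('X * x) ^+ i.
have uv : hyp_poly n (1 - 'X * x) * hyp_poly n v = 1.
  rewrite -rmorphM; have -> : v = \sum_(i < n.+2) ('X * x) ^+ i.
    rewrite 2!big_ord_recl expr0 expr1 addrA; congr (_ + _).
    by rewrite mulr_sumr; apply: eq_bigr => i _; rewrite -exprD.
  rewrite -opprB mulNr -subrX1 opprB exprMn rmorphB rmorph1 /=.
  by rewrite hyp_poly_Xmul0 // subr0.
have -> : 1 + m%:P * 'X^(k.+1) + 'X^(k.+2) * r = 1 - 'X * x by rewrite /x !exprS; ring.
have -> : (hyp_poly n (1 - 'X * x))^-1 = hyp_poly n v.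
  apply: (@mulrI _ (hyp_poly n (1 - 'X * x))).
    by apply/unitrP; exists (hyp_poly n v); rewrite -{1}hyp_poly_comm.
  by rewrite uv mulrV //; apply/unitrP; exists (hyp_poly n v); rewrite -{1}hyp_poly_comm.
exists (- r + (m%:P + 'X * r) ^+ 2 * 'X^k * \sum_(i < n) ('X * x) ^+ i).
congr horner_mx; rewrite /v; set S := \sum_(i < n) _.
by rewrite /x !exprS rmorphN; ring.
Qed.

Lemma leadXz n k m u (a : int) : (0 < k)%N -> lead n k m u -> lead n k (m * a) (u ^ a).
Proof.
move=> k_gt0 lu.
have leadX (i : nat) : lead n k (m * i%:Z) (u ^+ i).
  elim: i => [|i IHi]; first by rewrite mulr0 expr0; exact: lead1.
  by rewrite exprS intS mulrDr mulr1; exact: leadM.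
by case: a => i; [exact: leadX | rewrite NegzE mulrN; exact: leadV].
Qed.

Lemma lead_next n k u : lead n k 0 u -> exists m, lead n k.+1 m u.
Proof.
move=> [r ->]; have [c [s ->]] := poly_cons0 r; exists c, s; congr horner_mx.
by rewrite !exprS; ring.
Qed.

Lemma lead_eq0 n k m : (0 < k <= n)%N -> lead n k m 1 -> m = 0.
Proof.
move=> /andP[_ le_kn] [r e]; apply: (@hyp_poly_lead n k m r) => //.
by rewrite -addrA rmorphD rmorph1 in e; apply: (@addrI _ 1); rewrite -e addr0.
Qed.

Lemma lead_gt n m u : lead n n.+1 m u -> u = 1.
Proof.
move=> [r ->]; rewrite mulrC -addrA !rmorphD rmorph1 /= !hyp_poly_Xmul0 //.
by rewrite !addr0.
Qed.

Lemma lead_unipotent n k m u : (0 < k)%N -> lead n k m u -> (u - 1) ^+ n.+1 = 0.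
Proof.
case: k => // k _ [r ->].
have -> : 1 + m%:P * 'X^(k.+1) + 'X^(k.+2) * r = 1 + 'X * ('X^k * (m%:P + 'X * r)).
  by rewrite !exprS; ring.
rewrite rmorphD rmorph1 addrC addKr -rmorphXn exprMn.
by rewrite /= hyp_poly_Xmul0.
Qed.

(** * Parity constraints on leading coefficients *)

(** The expansion of - h / (1 - h): the sign governs even degrees, the second-order term odd
    ones. *)
Lemma hyp_dualE n : (1 < n)%N -> exists s, hyp_dual n = - 'X * (1 + 'X + 'X^2 * s).
Proof.
case: n => [//|[//|n]] _; exists (\sum_(i < n) 'X^i).
rewrite /hyp_dual 3!big_ord_recl (eq_bigr (fun i : 'I_n => 'X^3 * 'X^i)) => [|i _].
  by rewrite -mulr_sumr /=; ring.
by rewrite -exprD.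
Qed.

Lemma hyp_dual_factorX (s : {poly int}) k : exists s',
  (1 + 'X + 'X^2 * s) ^+ k = 1 + k%:R * 'X + 'X^2 * s'.
Proof.
elim: k => [|k [w IHk]]; first by exists 0; ring.
exists (w + k%:R + 'X * w + s * (1 + k%:R * 'X + 'X^2 * w)).
by rewrite exprS IHk -natr1; ring.
Qed.

(** For k even the dual of h^k starts with + h^k, so p times its dual is 1 + 2m h^k + ..., and this
    must be 1. *)
Lemma Isom_lead_even n k m u : (1 < n)%N -> (0 < k <= n)%N -> ~~ odd k ->
  Isom int n u -> lead n k m u -> m = 0.
Proof.
move=> n_gt1 /andP[k_gt0 le_kn] ek iu [r eu]; move: iu; rewrite {}eu => /Isom_hyp_polyP.
have [s es] := hyp_dualE n n_gt1; have [s' es'] := hyp_dual_factorX s k.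
have qk : hyp_dual n ^+ k = 'X^k * (1 + k%:R * 'X + 'X^2 * s').
  by rewrite es exprMn es' exprNn -signr_odd (negPf ek) mul1r.
rewrite !(comp_polyD, comp_polyM) !rmorphXn /= !comp_polyX !comp_polyC rmorph1.
set D := r \Po _; rewrite (exprS (hyp_dual n)) qk es => e.
suff: lead n k (m + m) 1 by move/lead_eq0 => /(_ _)/eqP; lia.
case: k => // k in k_gt0 le_kn ek es' qk e *; rewrite -e.
pose w := m%:P * (k.+1%:R + 'X * s')
  - (1 + 'X + 'X^2 * s) * (1 + k.+1%:R * 'X + 'X^2 * s') * D.
exists (r + w + 'X^k * (m%:P + 'X * r) * (m%:P + 'X * w)).
by congr horner_mx; rewrite /w !(exprS 'X); ring.
Qed.

(** For p = 1 + m h^k + c h^(k+1) + ... with k odd, the dual is 1 - m h^k + (c - k m) h^(k+1) + ....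
    The terms in h^k cancel, and degree k + 1 gives 2c = k m. The bound k > 1 keeps m^2 h^(2k) out
    of that degree, and k < n keeps h^(k+1) nonzero. *)
Lemma Isom_lead_odd n k m u : (1 < k < n)%N -> odd k ->
  Isom int n u -> lead n k m u -> exists m', m = m' *+ 2.
Proof.
move=> /andP[k_gt1 lt_kn] ok iu [r0 eu]; move: iu; rewrite {}eu => /Isom_hyp_polyP.
have [c [r ->]] := poly_cons0 r0.
have [s es] := hyp_dualE n (ltn_trans k_gt1 lt_kn).
have [s' es'] := hyp_dual_factorX s k.
have qk : hyp_dual n ^+ k = - 'X^k * (1 + k%:R * 'X + 'X^2 * s').
  by rewrite es exprMn es' exprNn -signr_odd ok expr1 mulN1r.
rewrite !(comp_polyD, comp_polyM) !rmorphXn /= !comp_polyX !comp_polyC rmorph1.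
set D := r \Po _; rewrite (exprS (hyp_dual n)) qk es => e.
suff: lead n k.+1 (c + c - k%:R * m) 1.
  move/lead_eq0 => /(_ lt_kn) /eqP; rewrite subr_eq0 natz => /eqP e2.
  (* The witness is c - ((k - 1) / 2) m, half of m because 2c = k m. *)
  exists (m - k./2%:Z * m + c - m).
  by have := odd_double_half k; rewrite ok; nia.
case: k => // [[//|k]] in k_gt1 lt_kn ok es' qk e *; rewrite -e.
pose K : {poly int} := k.+2%:R; pose S := 1 + 'X + 'X^2 * s.
pose S' := 1 + K * 'X + 'X^2 * s'.
(* With k now written [k.+2], w is the part of the dual beyond degree [k.+3], divided by
   X^(k.+4). *)
pose w := - m%:P * s' + c%:P * ((1 + 'X * s) * S' + K + 'X * s') - S ^+ 2 * S' * D.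
exists (r + w + 'X^k * (m%:P + c%:P * 'X + 'X^2 * r)
  * (- m%:P + (c%:P - K * m%:P) * 'X + 'X^2 * w)).
by congr horner_mx; rewrite /w /S /S' /K !(exprS 'X); ring.
Qed.

(** * Integral isometries in the identity component *)

Lemma hyp_poly_comm_twist n p : GRing.comm (hyp_poly n p) (twist_mx n).
Proof. by rewrite twist_hyp_poly; exact: hyp_poly_comm. Qed.

(** [hyp_dual n] has no constant term, so p and its dual share c, and constant terms give c^2 =
    1. *)
Lemma Isom_constant_term n p c : (1 < n)%N ->
  Isom int n (hyp_poly n (c%:P + 'X * p)) -> c = 1 \/ c = -1.
Proof.
move=> n_gt1 /Isom_hyp_polyP; have [s ->] := hyp_dualE n n_gt1.
rewrite !(comp_polyD, comp_polyM) comp_polyX comp_polyC; set D := p \Po _ => e.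
suff: c * c - 1 = 0.
  by move/eqP; rewrite subr_eq0 -expr2 sqrf_eq1 => /orP[]/eqP; [left|right].
pose S := 1 + 'X + 'X^2 * s.
apply: (@hyp_poly_lead n 0 _ (p * c%:P - c%:P * S * D - 'X * p * S * D)) => //.
have -> : (c * c - 1)%:P * 'X^0 + 'X^1 * (p * c%:P - c%:P * S * D - 'X * p * S * D)
    = (c%:P + 'X * p) * (c%:P + - 'X * (1 + 'X + 'X^2 * s) * D) - 1.
  by rewrite /S; ring.
by rewrite rmorphB /= e rmorph1 subrr.
Qed.

Lemma lead_Isom_eR (R : realType) n m u :
  Isom int n u -> lead n 1 m u -> Isom_eR R n (map_mx intr u).
Proof.
move=> iu lu; apply: unipotent_Isom_eR; last exact/Isom_map.
rewrite -(rmorph1 (map_mx (intr : int -> R))) -rmorphB -rmorphXn /=.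
by rewrite (lead_unipotent n 1 m u) // map_mx0.
Qed.

(** Having a symbol in degree 1 means constant term 1. Such u are unipotent, hence connected to 1;
    in odd rank the determinant excludes constant term -1. *)
Lemma Isom_eP (R : realType) n u : (1 < n)%N -> ~~ odd n ->
  Isom_e R n u <-> Isom int n u /\ exists m, lead n 1 m u.
Proof.
move=> n_gt1 en; split=> [[iu cu]|[iu [m lu]]]; last first.
  by split=> //; exact: lead_Isom_eR lu.
split=> //; have [p ep] := Isom_hyp_poly n u iu.
have [c [p' ep']] := poly_cons0 p; have [c' [r er]] := poly_cons0 p'.
move: (iu); rewrite ep ep' => /(Isom_constant_term _ _ _ n_gt1)[] c1.
  by exists c', r; congr horner_mx; rewrite c1 er; ring.
(* Otherwise - u lies in the identity component, although n + 1 is odd. *)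
have lNu : lead n 1 (- c') (- u).
  by exists (- r); rewrite ep ep' -rmorphN; congr horner_mx; rewrite c1 er; ring.
have iNu : Isom int n (- u).
  by move/IsomP: iu => iu; apply/IsomP; rewrite linearN /= !mulNmx mulmxN opprK.
have := Isom_eR_det _ (lead_Isom_eR R n _ _ iNu lNu).
rewrite map_mxN -scaleN1r detZ (Isom_eR_det _ cu) mulr1 exprS.
rewrite -signr_odd (negPf en) expr0 mulr1 => /eqP.
by rewrite eq_sym -subr_eq0 opprK -mulr2n pnatr_eq0.
Qed.

Lemma Isom_e_unit_subgroup (R : realType) n : (1 < n)%N -> ~~ odd n ->
  unit_subgroup (Isom_e R n).
Proof.
move=> n_gt1 en; split=> [u [[] //]||u v|u].
- by apply/Isom_eP => //; split; [exact: Isom1|exists 0; exact: lead1].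
- move=> /(Isom_eP _ _ _ n_gt1 en)[iu [m lu]] /(Isom_eP _ _ _ n_gt1 en)[iv [m' lv]].
  by apply/Isom_eP => //; split; [exact: IsomM|exists (m + m'); exact: leadM].
- move=> /(Isom_eP _ _ _ n_gt1 en)[iu [m lu]].
  by apply/Isom_eP => //; split; [exact: IsomV|exists (- m); exact: leadV].
Qed.

Lemma unit_subgroup_exprz (U : unitRingType) (S : set U) x (a : int) :
  unit_subgroup S -> S x -> S (x ^ a).
Proof.
move=> [_ S1 SM SV] Sx.
have SX i : S (x ^+ i) by elim: i => // i IHi; rewrite exprS; exact: SM.
by case: a => i; [exact: SX | rewrite NegzE; apply: SV; exact: SX].
Qed.

(** * Tensor products as operators *)

Lemma comm_twist_eq n (M N : 'M[int]_n.+1) :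
  GRing.comm M (twist_mx n) -> GRing.comm N (twist_mx n) ->
  delta_mx 0 0 *m M = delta_mx 0 0 *m N :> 'rV_n.+1 -> M = N.
Proof.
move=> cM cN e; apply: row_twist_eq => i; rewrite -!mulmxA !mulmxE.
by rewrite -(commrX i cM) -(commrX i cN) -!mulmxE !mulmxA e.
Qed.

Lemma tensor_mxE n (F : K0 int n) :
  tensor_mx F = \sum_(j < n.+1) F 0 j *: twist_mx n ^+ j.
Proof. by apply/row_matrixP => i; rewrite !rowE mul_tensor_mx tensorE. Qed.

Lemma tensor_mx_comm n (F : K0 int n) : GRing.comm (tensor_mx F) (twist_mx n).
Proof.
apply: commr_sym; rewrite tensor_mxE; apply: commr_sum => j _.
rewrite /GRing.comm -mulmxE -scalemxAr -scalemxAl; congr (_ *: _).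
exact: (commrX j (commr_refl _)).
Qed.

Lemma tensor_mxD n (E F : K0 int n) : tensor_mx (E + F) = tensor_mx E + tensor_mx F.
Proof.
by rewrite !tensor_mxE -big_split; apply: eq_bigr => j _; rewrite mxE scalerDl.
Qed.

Lemma tensor_mxB n (E F : K0 int n) : tensor_mx (E - F) = tensor_mx E - tensor_mx F.
Proof.
by rewrite !tensor_mxE -sumrB; apply: eq_bigr => j _; rewrite !mxE scalerBl.
Qed.

Lemma tensor_mxMn n (E : K0 int n) k : tensor_mx (E *+ k) = tensor_mx E *+ k.
Proof.
rewrite !tensor_mxE -sumrMnl; apply: eq_bigr => j _.
by rewrite mulmxnE scalerMnl.
Qed.

Lemma delta_tensor_mx n (F : K0 int n) : delta_mx 0 0 *m tensor_mx F = F.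
Proof.
rewrite tensor_mxE mulmx_sumr [RHS]row_sum_delta; apply: eq_bigr => j _.
by rewrite -scalemxAr delta_twist.
Qed.

Lemma tensor_mx_O n k : tensor_mx (O_ n k) = twist_mx n ^ k.
Proof.
apply: comm_twist_eq; first exact: tensor_mx_comm.
  exact/commr_sym/commrXz/commr_refl.
by rewrite delta_tensor_mx.
Qed.

Lemma tensor_mx_tensor n (E F : K0 int n) :
  tensor_mx (tensor E F) = tensor_mx E * tensor_mx F.
Proof.
apply: comm_twist_eq; first exact: tensor_mx_comm.
  by apply/commr_sym/commrM; exact/commr_sym/tensor_mx_comm.
by rewrite -mulmxE mulmxA !delta_tensor_mx mul_tensor_mx.
Qed.

Lemma tensor_mx_O_P n m : tensor_mx (O_P n m) = hyp_mx n ^+ (n - m).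
Proof.
rewrite /O_P /tensor_exp; elim: (n - m)%N => [|k IHk].
  by rewrite tensor_mx_O.
rewrite iterS tensor_mx_tensor IHk exprS; congr (_ * _).
by rewrite tensor_mxB !tensor_mx_O expr0z exprN1.
Qed.

(** * The generators are isometries *)

Lemma hyp_dual_cancel n k j :
  hyp_poly n (hyp_dual n ^+ k * (1 - 'X) ^+ (k + j))
    = hyp_poly n ((- 'X) ^+ k * (1 - 'X) ^+ j).
Proof.
rewrite exprD mulrA -exprMn !rmorphM !rmorphXn; congr (_ ^+ k * _).
rewrite rmorphM /= hyp_poly_dual -twistV_hyp_poly mulrBl mul1r mulrV ?twist_unit //.
by rewrite rmorphN /= hyp_polyX /hyp_mx opprB.
Qed.

(* Since (1 - h) times the dual of h is - h, multiplying p * dual p = 1 by    *)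
(* (1 - h)^n clears the denominators of the dual.                             *)
Lemma Isom_homogenized n (p w : {poly int}) : (size p <= n.+1)%N ->
  p * (\sum_(k < n.+1) (p`_k)%:P * ((- 'X) ^+ k * (1 - 'X) ^+ (n - k)))
    = (1 - 'X) ^+ n + 'X^(n.+1) * w ->
  Isom int n (hyp_poly n p).
Proof.
move=> sz_p e; apply/Isom_hyp_polyP.
have u : hyp_poly n ((1 - 'X) ^+ n) \is a GRing.unit.
  by rewrite rmorphXn /= -twistV_hyp_poly unitrX // unitrV twist_unit.
apply: (mulIr u); rewrite mul1r -rmorphM -mulrA.
transitivity (hyp_poly n ((1 - 'X) ^+ n + 'X^(n.+1) * w)); last first.
  by rewrite rmorphD /= hyp_poly_Xmul0 // addr0.
rewrite -e rmorphM [RHS]rmorphM /=; congr (_ * _).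
rewrite comp_polyE (big_ord_widen _ (fun k => p`_k *: hyp_dual n ^+ k) sz_p).
rewrite [RHS]rmorph_sum /= mulr_suml rmorph_sum /= big_mkcond /=; apply: eq_bigr => k _.
case: ifPn => [_|]; last first.
  by rewrite -leqNgt => /leq_sizeP/(_ _ (leqnn _)) ->; rewrite mul0r !rmorph0.
rewrite -mul_polyC -mulrA rmorphM [RHS]rmorphM /=; congr (_ * _).
by rewrite -hyp_dual_cancel subnKC // leq_ord.
Qed.

(** Since the class of P_m acts as h^(6-m), coefficients are listed by codimension. *)
Definition cubic_poly : {poly int} := Poly [:: 1; 0; 0; 2; 3; 4; 7].
Definition quintic_poly : {poly int} := Poly [:: 1; 0; 0; 0; 0; 2; 5].

Lemma cubic_polyE :
  cubic_poly = 1 + 'X^3 *+ 2 + 'X^4 *+ 3 + 'X^5 *+ 4 + 'X^6 *+ 7.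
Proof. by rewrite /cubic_poly /= !cons_poly_def; ring. Qed.

Lemma quintic_polyE : quintic_poly = 1 + 'X^5 *+ 2 + 'X^6 *+ 5.
Proof. by rewrite /quintic_poly /= !cons_poly_def; ring. Qed.

Lemma Isom_cubic : Isom int 6 (hyp_poly 6 cubic_poly).
Proof.
(* The cofactor is the quotient by X^7 of the left-hand product minus (1 - X)^6. *)
apply: (@Isom_homogenized 6 _ (45 * 'X - 90 * 'X^2 + 131 * 'X^3 - 86 * 'X^4
                              + 119 * 'X^5)).
  exact: size_Poly.
by rewrite !big_ord_recl big_ord0 !coef_Poly /= cubic_polyE; ring.
Qed.

Lemma Isom_quintic : Isom int 6 (hyp_poly 6 quintic_poly).
Proof.
apply: (@Isom_homogenized 6 _ (35 * 'X - 70 * 'X^2 + 59 * 'X^3 - 24 * 'X^4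
                              + 40 * 'X^5)).
  exact: size_Poly.
by rewrite !big_ord_recl big_ord0 !coef_Poly /= quintic_polyE; ring.
Qed.

Lemma lead_twist : lead 6 1 1 (twist_mx 6).
Proof.
exists (1 + 'X + 'X^2 + 'X^3 + 'X^4); rewrite twist_hyp_poly; congr horner_mx.
by rewrite !big_ord_recl big_ord0 /=; ring.
Qed.

Lemma lead_cubic : lead 6 3 2 (hyp_poly 6 cubic_poly).
Proof. by exists (3 + 4 * 'X + 7 * 'X^2); congr horner_mx; rewrite cubic_polyE; ring. Qed.

Lemma lead_quintic : lead 6 5 2 (hyp_poly 6 quintic_poly).
Proof. by exists 5; congr horner_mx; rewrite quintic_polyE; ring. Qed.

Lemma tensor_mx_cubic :
  tensor_mx (O_ 6 0 + O_P 6 3 *+ 2 + O_P 6 2 *+ 3 + O_P 6 1 *+ 4 + O_P 6 0 *+ 7)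
    = hyp_poly 6 cubic_poly.
Proof.
rewrite 4!tensor_mxD !tensor_mxMn !tensor_mx_O_P tensor_mx_O cubic_polyE.
by rewrite 4!rmorphD !rmorphMn rmorph1 !rmorphXn /= hyp_polyX.
Qed.

Lemma tensor_mx_quintic :
  tensor_mx (O_ 6 0 + O_P 6 1 *+ 2 + O_P 6 0 *+ 5) = hyp_poly 6 quintic_poly.
Proof.
rewrite 2!tensor_mxD !tensor_mxMn !tensor_mx_O_P tensor_mx_O quintic_polyE.
by rewrite 2!rmorphD !rmorphMn rmorph1 !rmorphXn /= hyp_polyX.
Qed.

(** * Existence and uniqueness of the exponents *)

Local Notation U_mx := (hyp_poly 6 cubic_poly).
Local Notation V_mx := (hyp_poly 6 quintic_poly).

Lemma Isom_twist n : Isom int n (twist_mx n).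
Proof. exact/IsomP/twist_chi. Qed.

Lemma IsomXz n (M : 'M[int]_n.+1) (a : int) : Isom int n M -> Isom int n (M ^ a).
Proof. by move=> iM; case: a => k; [|rewrite NegzE; apply: IsomV]; exact: IsomX. Qed.

(** Symbols of degrees 1, 3, 5 are cancelled by powers of the generators, those of degrees 2, 4, 6
    vanish, and beyond degree 6 only 1 is left. *)
Lemma Isom_e_decomposition (R : realType) u : Isom_e R 6 u ->
  exists a b c : int, u = twist_mx 6 ^ a * U_mx ^ b * V_mx ^ c.
Proof.
move=> /(Isom_eP R 6 u isT isT)[iu [a lu]].
(* If the symbol of v is m times that of g, dividing v by g^m moves it one degree deeper. *)
have peel v g k (x : int) m : (0 < k)%N -> g \is a GRing.unit ->
    Isom int 6 g -> Isom int 6 v -> lead 6 k x g -> lead 6 k (x * m) v ->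
    exists w, [/\ v = g ^ m * w, Isom int 6 w & exists m', lead 6 k.+1 m' w].
  move=> k0 ug ig iv lg lv; exists (g ^ (- m) * v); split.
  - by rewrite mulrA -exprzDr // subrr mul1r.
  - by apply: IsomM => //; exact: IsomXz.
  - by apply: lead_next; have := leadM _ _ _ _ _ _ k0 (leadXz _ _ _ _ (- m) k0 lg) lv;
      rewrite mulrN addNr.
have uI g : Isom int 6 g -> g \is a GRing.unit by case.
have [|w1 [-> i1 [m2 l2]]] :=
  peel u (twist_mx 6) 1%N 1 a isT (twist_unit 6) (Isom_twist 6) iu lead_twist.
  by rewrite mul1r.
have m20 := Isom_lead_even 6 2 m2 w1 isT isT isT i1 l2.
rewrite m20 in l2; have [m3 l3] := lead_next _ _ _ l2.
have [b eb] := Isom_lead_odd 6 3 m3 w1 isT isT i1 l3.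
have [|w2 [-> i2 [m4 l4]]] :=
  peel w1 U_mx 3%N 2 b isT (uI _ Isom_cubic) Isom_cubic i1 lead_cubic.
  by rewrite mulr_natl -eb.
have m40 := Isom_lead_even 6 4 m4 w2 isT isT isT i2 l4.
rewrite m40 in l4; have [m5 l5] := lead_next _ _ _ l4.
have [c ec] := Isom_lead_odd 6 5 m5 w2 isT isT i2 l5.
have [|w3 [-> i3 [m6 l6]]] :=
  peel w2 V_mx 5%N 2 c isT (uI _ Isom_quintic) Isom_quintic i2 lead_quintic.
  by rewrite mulr_natl -ec.
have m60 := Isom_lead_even 6 6 m6 w3 isT isT isT i3 l6.
rewrite m60 in l6; have [m7 l7] := lead_next _ _ _ l6.
by exists a, b, c; rewrite (lead_gt _ _ _ l7) mulr1 mulrA.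
Qed.

Lemma lead_weaken n k m u : lead n k.+1 m u -> lead n k 0 u.
Proof.
by move=> [r ->]; exists (m%:P + 'X * r); congr horner_mx; rewrite !(exprS 'X); ring.
Qed.

(** Degree 1 sees only a; once a = 0, degree 3 sees only 2b, and then degree 5 only 2c. *)
Lemma decomposition_inj (a b c : int) :
  twist_mx 6 ^ a * U_mx ^ b * V_mx ^ c = 1 -> [/\ a = 0, b = 0 & c = 0].
Proof.
have lT := leadXz 6 1 _ _ a isT lead_twist.
have lU := leadXz 6 3 _ _ b isT lead_cubic.
have lV := leadXz 6 5 _ _ c isT lead_quintic.
have lU1 := lead_weaken _ _ _ _ (lead_weaken _ _ _ _ lU).
have lV3 := lead_weaken _ _ _ _ (lead_weaken _ _ _ _ lV).
have lV1 := lead_weaken _ _ _ _ (lead_weaken _ _ _ _ lV3).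
move=> e1; have a0 : a = 0.
  have := leadM 6 1 _ _ _ _ isT (leadM 6 1 _ _ _ _ isT lT lU1) lV1.
  by rewrite e1 => /(lead_eq0 6 1 _ isT); lia.
rewrite a0 expr0z mul1r in e1; have b0 : b = 0.
  by have := leadM 6 3 _ _ _ _ isT lU lV3; rewrite e1 => /(lead_eq0 6 3 _ isT); lia.
rewrite b0 expr0z mul1r in e1; split=> //.
by rewrite e1 in lV; move: lV => /(lead_eq0 6 5 _ isT); lia.
Qed.

Theorem proposition13 (R : realType) :
  (exists phi : 'rV[int]_3 -> 'M[int]_7,
      {morph phi : a b / a + b >-> a * b} /\
      set_bij [set: 'rV[int]_3] (Isom_e R 6) phi) /\
  generated_subgroup
    [set tensor_mx (O_ 6 1);
         tensor_mx (O_ 6 0 + O_P 6 3 *+ 2 + O_P 6 2 *+ 3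
                    + O_P 6 1 *+ 4 + O_P 6 0 *+ 7);
         tensor_mx (O_ 6 0 + O_P 6 1 *+ 2 + O_P 6 0 *+ 5)]
  = Isom_e R 6.
Proof.
rewrite tensor_mx_O expr1z tensor_mx_cubic tensor_mx_quintic.
have sub := @Isom_e_unit_subgroup R 6 isT isT; have [subU _ subM _] := sub.
have eT : Isom_e R 6 (twist_mx 6).
  by apply/Isom_eP => //; split; [exact: Isom_twist | exists 1; exact: lead_twist].
have eU : Isom_e R 6 U_mx.
  apply/Isom_eP => //; split; first exact: Isom_cubic.
  by exists 0; exact/lead_weaken/lead_weaken/lead_cubic.
have eV : Isom_e R 6 V_mx.
  apply/Isom_eP => //; split; first exact: Isom_quintic.
  by exists 0; do 4!apply: lead_weaken; exact: lead_quintic.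
have eM a b c : Isom_e R 6 (twist_mx 6 ^ a * U_mx ^ b * V_mx ^ c).
  by apply: (subM); [apply: (subM)|]; exact: unit_subgroup_exprz.
split; last first.
  apply/seteqP; split; first by apply: smallest_sub => // _ [[->|->]|->].
  move=> u /Isom_e_decomposition[a [b [c ->]]] G [sG genG]; have [_ _ GM _] := sG.
  by apply: (GM); [apply: (GM)|]; apply: unit_subgroup_exprz => //; apply: genG;
    [left; left | left; right | right].
exists (fun x => twist_mx 6 ^ (x 0 0) * U_mx ^ (x 0 1) * V_mx ^ (x 0 2%:R)).
set phi := (fun x : 'rV[int]_3 => _).
have uT := subU _ eT; have uU := subU _ eU; have uV := subU _ eV.
have phiM : {morph phi : a b / a + b >-> a * b}.
  move=> x y; rewrite /phi !mxE !exprzDr //.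
  have commXz (u v : 'M[int]_7) (a b : int) :
      GRing.comm u v -> GRing.comm (u ^ a) (v ^ b).
    by move=> cuv; apply: commrXz; apply/commr_sym/commrXz/commr_sym.
  have cUT := commXz _ _ (x 0 1) (y 0 0) (hyp_poly_comm_twist 6 cubic_poly).
  have cVT := commXz _ _ (x 0 2%:R) (y 0 0) (hyp_poly_comm_twist 6 quintic_poly).
  have cVU := commXz V_mx U_mx (x 0 2%:R) (y 0 1) (hyp_poly_comm _ _ _).
  rewrite -!mulrA; congr (_ * _).
  rewrite [in RHS](mulrA (V_mx ^ _)) cVT -[in RHS](mulrA _ (V_mx ^ _)).
  rewrite [in RHS](mulrA (U_mx ^ _)) cUT -[in RHS](mulrA _ (U_mx ^ _)).
  by rewrite [in RHS](mulrA (V_mx ^ _)) cVU -[in RHS](mulrA _ (V_mx ^ _)).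
split=> //; split=> [x _|x y _ _ exy|u]; first exact: eM.
  (* [phi] is a homomorphism, so injectivity reduces to its kernel. *)
  have : phi (x - y) = 1.
    have u1 : phi y \is a GRing.unit by apply: subU; exact: eM.
    by apply: (mulIr u1); rewrite -phiM subrK mul1r.
  rewrite /phi !mxE => /decomposition_inj[x0 x1 x2].
  apply/eqP; rewrite -subr_eq0; apply/eqP/rowP => i; rewrite !mxE.
  case: i => [[|[|[|//]]] lt_i]; [rewrite -[RHS]x0|rewrite -[RHS]x1|rewrite -[RHS]x2];
    by congr (x _ _ - y _ _); exact: val_inj.
move=> /Isom_e_decomposition[a [b [c ->]]]; exists (\row_i [:: a; b; c]`_i) => //.
by rewrite /phi !mxE.
Qed.
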